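(* Let $3\le\alpha<\omega$ and let $p$ be an odd prime power. Then $\mathcal{A}^*_p\models e_q$ for all odd prime powers $q$ different from $p$.
   Context: An ordinal is the set of smaller ordinals; sequences $s\in U^\alpha$ are functions $\alpha\to U$. For a set $U$ and $X\subseteq U^\alpha$: $+$ and $-$ denote union and complement with respect to $U^\alpha$, $C_i(X)=\{s\in U^\alpha: s \text{ agrees with some } s'\in X \text{ off } i\}$, $D_{ij}=\{s\in U^\alpha: s_i=s_j\}$, and for a permutation $\tau$ of $\alpha$, $S_\tau X=\{s\in U^\alpha: s\circ\tau\in X\}$; $P_{ij}=S_{[i,j]}$, where $[i,j]$ interchanges $i,j$ and fixes all else. $P(\alpha)$ is the set of permutations of $\alpha$. Construction of $\mathcal{A}_p^*$ ($p\ge3$ an odd prime power). $U=U_0\cup U_1\cup\dots\cup U_{\alpha-2}$ is a disjoint union with $|U_0|=p^2$, $|U_k|=p-1$ for $1\le k\le\alpha-2$. $U_0$ is the point set of the affine plane $AG(2,p)$ over the field $GF(p)$ with $p$ elements; $\Lambda_0,\dots,\Lambda_p$ are the $p+1$ parallel classes of its lines, and $R_i=\{(u,v)\in U_0\times U_0: u\neq v,\ u,v\text{ lie on a common line of }\Lambda_i\}$ for $i<p+1$. $T=U_1\times\dots\times U_{\alpha-2}$. $Q_0,\dots,Q_{p-2}$ is a partition of the $\alpha$-place relation $R_0\times T$ into $p-1$ mutually disjoint relations such that for all $k<p-1$: $C_i(Q_k)=C_i(R_0\times T)$ for all $i<\alpha$, and $P_{01}(Q_k)=Q_{p-2-k}$.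 $A$ is the smallest set of subsets of $U^\alpha$ containing all $Q_k$ ($k<p-1$), all $R_i\times T$ ($1\le i<p+1$) and all $D_{ij}$, and closed under $+,-,C_i,P_{ij}$ ($i,j<\alpha$). For $\tau\in P(\alpha)$ let $\tau^+=\tau$ if $\tau(0)<\tau(1)$ and $\tau^+=\tau\circ[0,1]$ otherwise. The sets $S_\tau Q_k$ are atoms of the finite Boolean algebra $A$. The operation $P^*_{01}:A\to A$ is the additive function with $P^*_{01}(S_{\tau^+}Q_k)=S_{([0,1]\circ\tau^+)^+}Q_k$ for $\tau\in P(\alpha)$, $k<p-1$, and $P^*_{01}(a)=P_{01}(a)$ for the other atoms $a$ (this is well defined). $\mathcal{A}^*_p=\langle A,+,-,C_i,D_{ij},P^*_{01}\rangle_{i,j<\alpha}$; in it the symbols $c_i,d_{ij},p_{01}$ denote $C_i,D_{ij},P_{01}^*$. The equation $e_q$ ($q$ an odd prime power). In the language $+,-,c_i,d_{ij},p_{01}$ write $x\cdot y=-(-x+-y)$, $x-y=x\cdot(-y)$, $x\oplus y=(x\cdot-y)+(-x\cdot y)$, $0,1$ for the Boolean constants, $x\le y$ for $x+y=y$, $s^i_jx=c_i(d_{ij}\cdot x)$ for $i\ne j$, ${}_2s(0,1)x=s^2_0s^0_1s^1_2x$, and $x;y=c_2(s^1_2x\cdot s^0_2y)$. $E_q$ is the following finite set of equations in the variables $x_0,\dots,x_q,y_0,\dots,y_{q-2}$. For $i,j<q+1$, $i\neq j$: $\sum\{x_m:m<q+1\}=c_1x_0\cdot c_0x_0-d_{01}$;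 $x_i\cdot x_j=0$; $x_i=c_2\cdots c_{\alpha-1}x_i$ and $x_i={}_2s(0,1)x_i$; $x_i;x_i\le x_i+d_{01}$; $c_1x_i=c_1x_0$; $c_0c_1x_i=1$; $x_i;x_j=\sum\{x_k:k<q+1,\ k\neq i,j\}$. For $i,j<q-1$, $i\ne j$: $c_1\cdots c_{\alpha-1}y_0=c_1x_0$; $y_i\le x_0$; $y_i\cdot y_j=0$; $c_0y_i=c_0y_0$; $c_1y_i=c_1y_0$; $p_{01}y_0=y_0$. Finally, $e_q$ is the equation $\prod\{-c_0c_1\cdots c_{\alpha-1}(\tau\oplus\sigma): (\tau=\sigma)\in E_q\}=0$, where $\prod$ is the finite Boolean product $\cdot$. *)

(* Defs.v *)
From HB Require Import structures.
From mathcomp Require Import all_boot all_order all_fingroup all_algebra.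

Set Implicit Arguments.
Unset Strict Implicit.
Unset Printing Implicit Defensive.

(* The dimension is alpha = n + 3 throughout, so that the
   hypothesis 3 <= alpha < omega is built in and 'I_n.+3 is alpha. *)

Definition odd_prime_power (p : nat) : Prop :=
  odd p /\ exists r k : nat, [/\ prime r, 0 < k & p = r ^ k].

Definition i0 {n} : 'I_n.+3 := ord0.
Definition i1 {n} : 'I_n.+3 := @Ordinal n.+3 1 isT.
Definition i2 {n} : 'I_n.+3 := @Ordinal n.+3 2 isT.

Record alg (n : nat) := Alg {
  car :> Type;
  add : car -> car -> car;
  compl : car -> car;
  cyl : 'I_n.+3 -> car -> car;
  diag : 'I_n.+3 -> 'I_n.+3 -> car;
  p01 : car -> car
}.

Inductive var := X of nat | Y of nat.

Inductive term (n : nat) :=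
| TVar of var
| TAdd of term n & term n
| TCompl of term n
| TCyl of 'I_n.+3 & term n
| TDiag of 'I_n.+3 & 'I_n.+3
| TP01 of term n.

Arguments TVar {n} _.
Arguments TDiag {n} _ _.

Definition equation (n : nat) : Type := (term n * term n)%type.

Fixpoint eval n (M : alg n) (v : var -> M) (t : term n) : M :=
  match t with
  | TVar z => v z
  | TAdd s u => add (eval v s) (eval v u)
  | TCompl s => compl (eval v s)
  | TCyl i s => cyl i (eval v s)
  | TDiag i j => diag M i j
  | TP01 s => p01 (eval v s)
  end.

Definition models n (M : alg n) (e : equation n) : Prop :=
  forall v : var -> M, eval v e.1 = eval v e.2.

Definition tmul n (s t : term n) := TCompl (TAdd (TCompl s) (TCompl t)).
Definition tsub n (s t : term n) := tmul s (TCompl t).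
Definition tsymd n (s t : term n) :=
  TAdd (tmul s (TCompl t)) (tmul (TCompl s) t).
(* The Boolean constants are not in the signature; they are d_01 + -d_01 and
   its complement. *)
Definition tone {n} : term n := TAdd (TDiag i0 i1) (TCompl (TDiag i0 i1)).
Definition tzero {n} : term n := TCompl tone.
Definition tle n (s t : term n) : equation n := (TAdd s t, t).

Definition tsum n (ts : seq (term n)) : term n := foldr (@TAdd n) tzero ts.
Definition tprod n (ts : seq (term n)) : term n := foldr (@tmul n) tone ts.

(* c_m c_(m+1) ... c_(alpha-1) t *)
Definition tcyls n (m : nat) (t : term n) : term n :=
  foldr (@TCyl n) t [seq i : 'I_n.+3 <- enum 'I_n.+3 | m <= i].

(* s^i_j t *)
Definition tsubst n (i j : 'I_n.+3) (t : term n) : term n :=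
  TCyl i (tmul (TDiag i j) t).

(* _2 s(0,1) t *)
Definition tconv n (t : term n) : term n :=
  tsubst i2 i0 (tsubst i0 i1 (tsubst i1 i2 t)).

(* s ; t *)
Definition tcomp n (s t : term n) : term n :=
  TCyl i2 (tmul (tsubst i1 i2 s) (tsubst i0 i2 t)).

Definition neq_pairs (m : nat) : seq (nat * nat) :=
  [seq ij <- [seq (i, j) | i <- iota 0 m, j <- iota 0 m] | ij.1 != ij.2].

Definition E_x1 n (q i : nat) : seq (equation n) :=
  let x k := TVar (X k) : term n in
  [:: (x i, tcyls 2 (x i));
      (x i, tconv (x i));
      tle (tcomp (x i) (x i)) (TAdd (x i) (TDiag i0 i1));
      (TCyl i1 (x i), TCyl i1 (x 0));
      (TCyl i0 (TCyl i1 (x i)), tone)].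

Definition E_x2 n (q i j : nat) : seq (equation n) :=
  let x k := TVar (X k) : term n in
  [:: (tmul (x i) (x j), tzero);
      (tcomp (x i) (x j),
       tsum [seq x k | k <- iota 0 q.+1 & (k != i) && (k != j)])].

Definition E_y1 n (i : nat) : seq (equation n) :=
  let y k := TVar (Y k) : term n in
  [:: tle (y i) (TVar (X 0));
      (TCyl i0 (y i), TCyl i0 (y 0));
      (TCyl i1 (y i), TCyl i1 (y 0))].

Definition eqns_E n (q : nat) : seq (equation n) :=
  let x k := TVar (X k) : term n in
  let y k := TVar (Y k) : term n in
  [:: (tsum [seq x m | m <- iota 0 q.+1],
       tsub (tmul (TCyl i1 (x 0)) (TCyl i0 (x 0))) (TDiag i0 i1))]
  ++ flatten [seq E_x1 n q i | i <- iota 0 q.+1]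
  ++ flatten [seq E_x2 n q ij.1 ij.2 | ij <- neq_pairs q.+1]
  ++ [:: (tcyls 1 (y 0), TCyl i1 (x 0)); (TP01 (y 0), y 0)]
  ++ flatten [seq E_y1 n i | i <- iota 0 q.-1]
  ++ [seq (tmul (y ij.1) (y ij.2), tzero) | ij <- neq_pairs q.-1].

Definition eqn_e n (q : nat) : equation n :=
  (tprod [seq TCompl (tcyls 0 (tsymd ts.1 ts.2)) | ts <- eqns_E n q], tzero).

Section SetOps.
Context {n : nat} {U : finType}.
Local Notation V := {ffun 'I_n.+3 -> U}.

Definition Cs (i : 'I_n.+3) (A : {set V}) : {set V} :=
  [set s : V | [exists s' in A, [forall j, (j != i) ==> (s j == s' j)]]].

Definition Ds (i j : 'I_n.+3) : {set V} := [set s : V | s i == s j].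

Definition Ss (t : 'S_n.+3) (A : {set V}) : {set V} :=
  [set s : V | [ffun i => s (t i)] \in A].

Definition Ps (i j : 'I_n.+3) (A : {set V}) : {set V} := Ss (tperm i j) A.

End SetOps.

(* Products in 'S_ _ are read from left to right: (s * t) i = t (s i), so the
   composite t o [0,1] is tperm i0 i1 * t, and [0,1] o t is t * tperm i0 i1. *)
Definition perm_plus n (t : 'S_n.+3) : 'S_n.+3 :=
  if t i0 < t i1 then t else (tperm i0 i1 * t)%g.

Definition ag_lines (F : finFieldType) : {set {set F * F}} :=
  [set L : {set F * F} | [exists a : F, exists b : F, exists c : F,
     ((a, b) != (0, 0)%R) &&
     (L == [set z : F * F | (a * z.1 + b * z.2 == c)%R])]].

Definition parallel (F : finFieldType) (L M : {set F * F}) : bool :=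
  (L == M) || [disjoint L & M].

Definition parallel_classes (F : finFieldType) : {set {set {set F * F}}} :=
  equivalence_partition (@parallel F) (ag_lines F).

(* The pairs of distinct points on a common line of the class Lam, the plane
   being embedded in U by pt. *)
Definition Rel (F : finFieldType) (U : finType) (pt : F * F -> U)
    (Lam : {set {set F * F}}) (u v : U) : bool :=
  (u != v) && [exists L in Lam, (u \in pt @: L) && (v \in pt @: L)].

(* R x T, where T is the product of U_1, ..., U_(alpha-2); as lift ord0 k is
   k + 1, the factor U_k sits at the coordinate k + 1. *)
Definition relT (n : nat) (U : finType) (Uk : 'I_n.+2 -> {set U})
    (R : U -> U -> bool) : {set {ffun 'I_n.+3 -> U}} :=
  [set s : {ffun 'I_n.+3 -> U} | R (s i0) (s i1) &&
     [forall k : 'I_n.+2, (k != ord0) ==> (s (lift ord0 k) \in Uk k)]].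

(* The choices made in the construction.  U_0 is identified with the point set
   F x F through pt; in particular |U_0| = p ^ 2.  Since the index type of Q
   has p - 1 elements, rev_ord k is p - 2 - k. *)
Record construction (n p : nat) := Data {
  GF : finFieldType;
  card_GF : #|GF| = p;
  U : finType;
  Uk : 'I_n.+2 -> {set U};
  Uk_disjoint : forall k l, k != l -> [disjoint Uk k & Uk l];
  Uk_cover : \bigcup_k Uk k = [set: U];
  card_Uk : forall k, k != ord0 -> #|Uk k| = p.-1;
  pt : GF * GF -> U;
  pt_inj : injective pt;
  pt_im : pt @: [set: GF * GF] = Uk ord0;
  Lam : 'I_p.+1 -> {set {set GF * GF}};
  Lam_inj : injective Lam;
  Lam_im : Lam @: [set: 'I_p.+1] = parallel_classes GF;
  Q : 'I_p.-1 -> {set {ffun 'I_n.+3 -> U}};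
  Q_disjoint : forall k l, k != l -> [disjoint Q k & Q l];
  Q_cover : \bigcup_k Q k = relT Uk (Rel pt (Lam ord0));
  Q_cyl : forall k i, Cs i (Q k) = Cs i (relT Uk (Rel pt (Lam ord0)));
  Q_swap : forall k, Ps i0 i1 (Q k) = Q (rev_ord k)
}.

Definition points n p (d : construction n p) : finType := {ffun 'I_n.+3 -> U d}.

Definition RT n p (d : construction n p) (i : 'I_p.+1) : {set points d} :=
  relT (@Uk n p d) (Rel (@pt n p d) (Lam d i)).

Definition gens n p (d : construction n p) : {set {set points d}} :=
  [set Q d k | k : 'I_p.-1] :|: [set RT d i | i : 'I_p.+1 & i != ord0]
  :|: [set Ds i j | i : 'I_n.+3, j : 'I_n.+3].

Definition op_closed n p (d : construction n p) (B : {set {set points d}}) : bool :=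
  [&& [forall a in B, forall b in B, a :|: b \in B],
      [forall a in B, ~: a \in B],
      [forall i, forall a in B, Cs i a \in B] &
      [forall i, forall j, forall a in B, Ps i j a \in B]].

Definition A n p (d : construction n p) : {set {set points d}} :=
  \bigcap_(B : {set {set points d}} | (gens d \subset B) && op_closed B) B.

Definition atom n p (d : construction n p) (a : {set points d}) : bool :=
  minset [pred b : {set points d} | (b \in A d) && (b != set0)] a.

(* The choice of (t, k) is immaterial: the set S_(t^+) Q_k determines both
   t^+ and k. *)
Definition Pstar_atom n p (d : construction n p) (a : {set points d}) :
    {set points d} :=
  match [pick tk : 'S_n.+3 * 'I_p.-1 | a == Ss (perm_plus tk.1) (Q d tk.2)] with
  | Some tk => Ss (perm_plus (perm_plus tk.1 * tperm i0 i1)%g) (Q d tk.2)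
  | None => Ps i0 i1 a
  end.

Definition Pstar n p (d : construction n p) (a : {set points d}) : {set points d} :=
  \bigcup_(b : {set points d} | atom b && (b \subset a)) Pstar_atom b.

Section Closure.
Context {n p : nat} (d : construction n p).

Lemma A_min (B : {set {set points d}}) :
  gens d \subset B -> op_closed B -> A d \subset B.
Proof. by move=> gB cB; apply: bigcap_inf; rewrite gB. Qed.

Lemma A_gens a : a \in gens d -> a \in A d.
Proof. by move=> ga; apply/bigcapP => B /andP[/subsetP gB _]; apply: gB. Qed.

Lemma A_setU a b : a \in A d -> b \in A d -> a :|: b \in A d.
Proof.
move=> /bigcapP ha /bigcapP hb; apply/bigcapP => B hB.
have /andP[_ /and4P[/forall_inP h _ _ _]] := hB.
exact: (forall_inP (h _ (ha _ hB)) _ (hb _ hB)).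
Qed.

Lemma A_setC a : a \in A d -> ~: a \in A d.
Proof.
move=> /bigcapP ha; apply/bigcapP => B hB.
have /andP[_ /and4P[_ /forall_inP h _ _]] := hB; exact: h (ha _ hB).
Qed.

Lemma A_Cs i a : a \in A d -> Cs i a \in A d.
Proof.
move=> /bigcapP ha; apply/bigcapP => B hB.
have /andP[_ /and4P[_ _ /forallP/(_ i)/forall_inP h _]] := hB.
exact: h (ha _ hB).
Qed.

Lemma A_Ps i j a : a \in A d -> Ps i j a \in A d.
Proof.
move=> /bigcapP ha; apply/bigcapP => B hB.
have /andP[_ /and4P[_ _ _ /forallP/(_ i)/forallP/(_ j)/forall_inP h]] := hB.
exact: h (ha _ hB).
Qed.

Lemma A_Ds i j : Ds i j \in A d.
Proof. by apply: A_gens; rewrite inE; apply/orP; right; apply: imset2_f. Qed.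

Lemma A_Q k : Q d k \in A d.
Proof. by apply: A_gens; rewrite !inE imset_f. Qed.

Lemma A_set0 : set0 \in A d.
Proof.
have -> : set0 = ~: Ds i0 i0 :> {set points d}.
  by apply/setP => s; rewrite !inE eqxx.
exact: A_setC (A_Ds _ _).
Qed.

Lemma A_Ss t a : a \in A d -> Ss t a \in A d.
Proof.
have [ts -> _] := prod_tpermP t.
elim: ts a => [|ij ts IH] a ha.
  suff -> : Ss (\prod_(t <- [::]) tperm t.1 t.2)%g a = a by [].
  apply/setP => s; rewrite inE big_nil.
  by congr (_ \in a); apply/ffunP => i; rewrite ffunE perm1.
suff -> : Ss (\prod_(t <- ij :: ts) tperm t.1 t.2)%g a =
          Ss (\prod_(t <- ts) tperm t.1 t.2)%g (Ps ij.1 ij.2 a).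
  exact/IH/A_Ps.
apply/setP => s; rewrite !inE big_cons; congr (_ \in a).
by apply/ffunP => i; rewrite !ffunE permM.
Qed.

Lemma A_Pstar a : Pstar a \in A d.
Proof.
rewrite /Pstar; elim/big_rec: _ => [|b x /andP[/minsetP[/andP[hb _] _] _] hx].
  exact: A_set0.
apply: A_setU hx; rewrite /Pstar_atom; case: pickP => [tk _|_].
  exact/A_Ss/A_Q.
exact: A_Ps.
Qed.

Definition Astar : alg n :=
  @Alg n {a : {set points d} | a \in A d}
    (fun a b => exist _ (sval a :|: sval b) (A_setU (svalP a) (svalP b)))
    (fun a => exist _ (~: sval a) (A_setC (svalP a)))
    (fun i a => exist _ (Cs i (sval a)) (A_Cs i (svalP a)))
    (fun i j => exist _ (Ds i j) (A_Ds i j))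
    (fun a => exist _ (Pstar (sval a)) (A_Pstar (sval a))).

End Closure.

(* Main.v *)
Require Import Defs.
From mathcomp Require Import all_boot all_order all_fingroup all_algebra.
From mathcomp Require Import ring.

(** A valuation violating [e_q] satisfies all the equations of [E_q], and these
    force [q = p].

    The equations on the [x_k] say that the [x_k] are binary relations on a set
    [X], each of which becomes an equivalence relation when the diagonal is
    added; they partition the pairs of distinct points of [X] and compose like
    the parallel classes of an affine plane. Hence their equivalence classes
    are the lines of an affine plane of order [q] with point set [X], and
    [X] has [q ^ 2] points ([xrel_plane], [plane_card]).

    On the other hand the members of the algebra have symmetries. Let [G] be
    the group of the permutations of [U] that are homotheties or translations
    on [U_0] and arbitrary permutations on each other [U_k]. The sets [Q_k]
    need not be invariant under [G], but [G] is transitive on [R_0 x T], and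
    [Q_k] has the same cylindrifications as [R_0 x T]. It follows that every
    member of the algebra is the union of a [G]-invariant set and of sets
    [S_t Q_k] ([A_tame]), and that its cylindrifications are [G]-invariant
    ([tame_Cs_invariant]). As [x_k] is equal to its own cylindrification in the
    directions [2, ..., alpha - 1], it is [G]-invariant.

    An affine plane invariant under [G] must have the point set [U_0]: two of
    its points in the same [U_k], [k >= 1], could be exchanged by a symmetry
    fixing all the other points, which is impossible for the geometry, and the
    translations are transitive on [U_0] ([symmetric_plane_order]). Therefore
    [q ^ 2 = p ^ 2]. *)

Set Implicit Arguments.
Unset Strict Implicit.
Unset Printing Implicit Defensive.

Import GRing.Theory.

(** * Counting the points of an affine plane *)

Lemma exists_neq_ord q (i : 'I_q.+1) : 0 < q -> exists j, j != i.
Proof.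
move=> q_gt0; exists (if i == ord0 then ord_max else ord0).
by case: (eqVneq i ord0) => [->|]; [rewrite -val_eqE /= -lt0n | rewrite eq_sym].
Qed.

Section PlaneRelations.
Context {T : finType} {q : nat}.
Context (X : {set T}) (r : 'I_q.+1 -> rel T).

(** An affine plane with point set [X] whose parallel classes are indexed by
    ['I_q.+1]: [r i u v] means that [u] and [v] are distinct and that the line
    joining them belongs to class [i]. The last clause makes a line of class
    [i] meet every line of another class [j]. *)
Definition plane_relations : Prop :=
  [/\ forall i u v, r i u v -> [/\ u \in X, v \in X & u != v],
      forall i u v, r i u v -> r i v u,
      forall i u v w, r i u v -> r i v w -> u = w \/ r i u w,
      forall i u, u \in X -> exists v, r i u v &
    [/\ forall u v, u \in X -> v \in X -> u != v -> exists i, r i u v,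
        forall i j u v, r i u v -> r j u v -> i = j &
        forall i j k u w, i != j -> k != i -> k != j -> r k u w ->
          exists2 v, r i u v & r j v w]].

Context (q_gt1 : 1 < q) (HX : plane_relations).

(** Lines have [q] points: if [v] is a point off the line [L] of class [i],
    then the [q] lines through [v] of a class other than [i] meet [L], each in
    a single point, and every point of [L] is joined to [v] by one of them. *)
Lemma plane_line_card i u : u \in X -> #|u |: [set v | r i u v]| = q.
Proof.
move=> uX; have [r_in r_sym r_tr r_ser [r_cov r_dis r_cmp]] := HX.
have [j jNi] := exists_neq_ord i (ltnW q_gt1).
have [v ruv] := r_ser j u uX; have [_ vX uv] := r_in _ _ _ ruv.
set L := u |: _.
have LX w : w \in L -> w \in X.
  by rewrite !inE => /predU1P[->//|/r_in[]].
have Lr w w' : w \in L -> w' \in L -> w != w' -> r i w w'.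
  rewrite !inE => /predU1P[->|hw] /predU1P[->|hw'] //; first by rewrite eqxx.
    by move=> _; apply: r_sym.
  by move=> ww'; case: (r_tr i w u w' (r_sym _ _ _ hw) hw') ww' => // ->; rewrite eqxx.
have vL : v \notin L.
  rewrite !inE eq_sym (negbTE uv) /=; apply/negP => /(r_dis _ _ _ _ ruv) ji.
  by rewrite ji eqxx in jNi.
(* The line of class k through v meets L. *)
have meet k : k != i -> exists2 w, w \in L & r k v w.
  move=> kNi; have [<-{k kNi}|jNk] := eqVneq j k.
    by exists u; [rewrite !inE eqxx | apply: r_sym].
  have [|w ruw rwv] := r_cmp i k j u v _ jNi jNk ruv; first by rewrite eq_sym.
  by exists w; [rewrite !inE ruw orbT | apply: r_sym].
have /fin_all_exists2[f fL rf] : forall k : {k : 'I_q.+1 | k != i},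
    exists2 w, w \in L & r (val k) v w by move=> k; apply: meet (valP k).
have f_inj : injective f.
  move=> k k' fkk'; apply: val_inj.
  by apply: (r_dis _ _ v (f k)) (rf k) _; rewrite fkk'.
have -> : L = f @: [set: {k : 'I_q.+1 | k != i}].
  apply/setP => w; apply/idP/imsetP => [wL|[k _ ->//]].
  have vw : v != w by apply: contraNneq vL => ->.
  have [k rk] := r_cov v w vX (LX w wL) vw.
  have kNi : k != i.
    apply/eqP => ki; rewrite {}ki in rk.
    case: (eqVneq w u) => [wu|wu].
      have := r_dis _ _ _ _ ruv (r_sym _ _ _ (eq_ind w (r i v) rk u wu)).
      by move=> ji; rewrite ji eqxx in jNi.
    have rwu : r i w u by apply: Lr => //; rewrite !inE eqxx.
    case: (r_tr _ _ _ _ rk rwu) => [vu|rvu]; first by rewrite vu eqxx in uv.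
    by have ji := r_dis _ _ _ _ ruv (r_sym _ _ _ rvu); rewrite ji eqxx in jNi.
  exists (Sub k kNi); first by rewrite inE.
  move: (f _) (fL (Sub k kNi)) (rf (Sub k kNi)) => w' w'L /= rf'.
  apply/eqP; apply: contraNT kNi => ww'.
  have rww' : r i w w' by apply: Lr.
  case: (r_tr _ _ _ _ (r_sym _ _ _ rk) rf') => [e|rk']; first by rewrite e eqxx in ww'.
  exact/eqP/r_dis/rww'.
by rewrite card_imset // cardsT card_sig cardC1 card_ord.
Qed.

(** The [q.+1] lines through a point [u] share only [u] and cover [X], which
    gives [1 + q.+1 * q.-1] points. *)
Lemma plane_card u : u \in X -> #|X| = q ^ 2.
Proof.
move=> uX; have [r_in r_sym r_tr r_ser [r_cov r_dis r_cmp]] := HX.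
have card_r i : #|[set v | r i u v]| = q.-1.
  have := plane_line_card i uX; rewrite cardsU1 inE.
  have -> : r i u u = false by apply/negP => /r_in[_ _]; rewrite eqxx.
  by move=> /= <-.
have XE : X = u |: \bigcup_i [set v | r i u v].
  apply/setP => v; rewrite !inE; have [->//|/= vu] := eqVneq v u.
  apply/idP/bigcupP => [vX|[i _]]; last by rewrite inE => /r_in[].
  by have [|i ri] := r_cov u v uX vX; [rewrite eq_sym | exists i; rewrite ?inE].
rewrite XE cardsU1.
have -> : u \notin \bigcup_i [set v | r i u v].
  by apply/bigcupP => -[i _]; rewrite inE => /r_in[_ _]; rewrite eqxx.
rewrite -sum1_card partition_disjoint_bigcup; last first.
  move=> i j ij; apply/pred0P => v /=; rewrite !inE.
  by apply/negP => /andP[ri rj]; rewrite (r_dis _ _ _ _ ri rj) eqxx in ij.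
under eq_bigr do rewrite sum1_card card_r.
by rewrite sum_nat_const card_ord; case: (q) q_gt1 => // m _ /=; rewrite -mulnn; ring.
Qed.
End PlaneRelations.

(** * Lines of the affine plane over a finite field and homotheties *)

Section AffinePlane.
Context {F : finFieldType}.
Implicit Types (a b c : F) (L M : {set F * F}).
Local Open Scope ring_scope.

Definition line a b c : {set F * F} := [set z | a * z.1 + b * z.2 == c].

Lemma ag_linesP L :
  reflect (exists a b c, (a, b) != (0, 0) /\ L = line a b c) (L \in ag_lines F).
Proof.
rewrite inE; apply: (iffP existsP) => [[a /existsP[b /existsP[c /andP[ab /eqP->]]]]|].
  by exists a, b, c.
by case=> a [b [c [ab ->]]]; exists a; apply/existsP; exists b; apply/existsP;
  exists c; rewrite ab eqxx.
Qed.

(** Lines with independent normal vectors meet, by Cramer's rule, and are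
    distinct since a line contains its translate by a direction vector. If
    the normal vectors are proportional, a common point makes the equations
    proportional. *)
Lemma parallel_lineE a b c a' b' c' : (a, b) != (0, 0) -> (a', b') != (0, 0) ->
  parallel (line a b c) (line a' b' c') = (a * b' == a' * b).
Proof.
move=> ab ab'; apply/idP/eqP => [|e].
  apply: contraTeq => det; have det0 : a * b' - a' * b != 0 by rewrite subr_eq0.
  pose D := a * b' - a' * b.
  (* The solution of the two line equations. *)
  pose z := ((c * b' - c' * b) / D, (a * c' - a' * c) / D).
  have z1 : z \in line a b c by rewrite inE /=; apply/eqP; rewrite /D; field.
  have z2 : z \in line a' b' c' by rewrite inE /=; apply/eqP; rewrite /D; field.
  move: z z1 z2 => z z1 z2; rewrite negb_or; apply/andP; split; last first.
    by apply/pred0Pn; exists z; rewrite !inE in z1 z2 *; rewrite z1.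
  apply: contraNneq det => LL.
  have : (z.1 - b, z.2 + a) \in line a b c.
    by move: z1; rewrite !inE /= => /eqP <-; apply/eqP; ring.
  move: z2; rewrite LL !inE /= => /eqP z2 /eqP h.
  apply/eqP/subr0_eq.
  transitivity (a' * (z.1 - b) + b' * (z.2 + a) - (a' * z.1 + b' * z.2)).
    by ring.
  by rewrite h z2 subrr.
have [m m0 [ea eb]] : exists2 m, m != 0 & a' = m * a /\ b' = m * b.
  have [a0|a0] := eqVneq a 0.
    have b0 : b != 0 by move: ab; rewrite a0 xpair_eqE eqxx.
    have a'0 : a' = 0.
      by move/eqP: e; rewrite a0 mul0r eq_sym mulf_eq0 (negbTE b0) orbF => /eqP.
    exists (b' / b); last by rewrite a0 a'0; split; field.
    by rewrite mulf_neq0 ?invr_eq0 //; move: ab'; rewrite a'0 xpair_eqE eqxx.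
  exists (a' / a); last by split; [field | rewrite mulrAC -e; field].
  rewrite mulf_neq0 ?invr_eq0 //; apply: contraNneq ab' => a'0.
  move/eqP: e; rewrite a'0 mul0r mulf_eq0 (negbTE a0) /= => /eqP->.
  by rewrite eqxx.
rewrite /parallel; case: eqVneq => //= LL.
apply/pred0P => z /=; rewrite !inE; apply: contraNF LL => /andP[/eqP ec /eqP ec'].
apply/eqP/setP => w; rewrite !inE -ec -ec' ea eb.
by rewrite -!mulrA -!mulrDr (inj_eq (mulfI m0)).
Qed.

Lemma parallel_sym L M : parallel L M = parallel M L.
Proof. by rewrite /parallel eq_sym disjoint_sym. Qed.

Lemma parallel_trans L M N : L \in ag_lines F -> M \in ag_lines F ->
  N \in ag_lines F -> parallel L M -> parallel M N -> parallel L N.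
Proof.
move=> /ag_linesP[a [b [c [ab ->]]]] /ag_linesP[a' [b' [c' [ab' ->]]]].
move=> /ag_linesP[a2 [b2 [c2 [ab2 ->]]]]; rewrite !parallel_lineE //.
move=> /eqP e1 /eqP e2; apply/eqP.
have [b'0|b'0] := eqVneq b' 0.
  have a'0 : a' != 0 by move: ab'; rewrite b'0 xpair_eqE eqxx andbT.
  apply: (mulfI a'0); rewrite mulrCA e2 b'0 mulr0 mulr0.
  by rewrite mulrCA -e1 b'0 !mulr0.
apply: (mulfI b'0); transitivity (a * b' * b2); first by ring.
by rewrite e1; transitivity (a' * b2 * b); [ring | rewrite e2; ring].
Qed.

(** Every member of a class serves as its representative, because parallelism
    is an equivalence relation. *)
Lemma parallel_class_mem (Lam : {set {set F * F}}) L M :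
  Lam \in parallel_classes F -> L \in Lam ->
  (M \in Lam) = (M \in ag_lines F) && parallel L M.
Proof.
case/imsetP => L0 L0l -> /=; rewrite [L \in _]inE => /andP[Ll L0L].
rewrite inE; case Ml: (M \in _) => //=; apply/idP/idP => h.
  by apply: parallel_trans h => //; rewrite parallel_sym.
exact: parallel_trans h.
Qed.

(** With [l != 0] this is a translation or a homothety, that is, a dilation of
    the plane: these maps send every line to a parallel one. *)
Definition homothety (l : F) (t z : F * F) : F * F :=
  (l * z.1 + t.1, l * z.2 + t.2).

Lemma homothety_inj l t : l != 0 -> injective (homothety l t).
Proof.
by move=> l0 [x y] [x' y'] [] /addIr/(mulfI l0)-> /addIr/(mulfI l0)->.
Qed.

Definition collinear_in (Lam : {set {set F * F}}) (z w : F * F) : bool :=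
  [exists L in Lam, (z \in L) && (w \in L)].

(** The homothety maps the line [a x + b y = c] to the line
    [a x + b y = l c + a t1 + b t2], which has the same normal vector. *)
Lemma homothety_collinear (Lam : {set {set F * F}}) l t z w :
  Lam \in parallel_classes F -> l != 0 -> collinear_in Lam z w ->
  collinear_in Lam (homothety l t z) (homothety l t w).
Proof.
move=> hLam l0 /exists_inP[L LLam /andP[zL wL]].
have Ll : L \in ag_lines F.
  by have := parallel_class_mem L hLam LLam; rewrite LLam => /esym/andP[].
have /ag_linesP[a [b [c [ab eL]]]] := Ll.
pose M := line a b (l * c + a * t.1 + b * t.2).
have Ml : M \in ag_lines F by apply/ag_linesP; exists a, b, (l * c + a * t.1 + b * t.2).
have mem_h x : x \in L -> homothety l t x \in M.
  by rewrite eL !inE /= => /eqP <-; apply/eqP; ring.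
apply/exists_inP; exists M; last by rewrite !mem_h.
by rewrite (parallel_class_mem M hLam LLam) Ml eL parallel_lineE ?eqxx.
Qed.

(** The vectors [z - w] and [z' - w'] are orthogonal to proportional normal
    vectors, hence are proportional; their ratio is [l]. *)
Lemma homothety_transitive (Lam : {set {set F * F}}) z w z' w' :
  Lam \in parallel_classes F -> z != w -> z' != w' ->
  collinear_in Lam z w -> collinear_in Lam z' w' ->
  exists l t, [/\ l != 0, homothety l t z = z' & homothety l t w = w'].
Proof.
move=> hLam zw zw' /exists_inP[L LLam /andP[zL wL]] /exists_inP[L' LLam' /andP[zL' wL']].
have := parallel_class_mem L' hLam LLam; rewrite LLam' => /esym/andP[L'l LL'].
have := parallel_class_mem L hLam LLam; rewrite LLam => /esym/andP[Ll _].
case/ag_linesP: Ll => a [b [c [ab eL]]]; case/ag_linesP: L'l => a' [b' [c' [ab' eL']]].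
move: LL' zL wL zL' wL'; rewrite {}eL {}eL' parallel_lineE // !inE.
case: z w z' w' zw zw' => [x y] [x1 y1] [x' y'] [x1' y1']; rewrite !xpair_eqE /=.
rewrite -(subr_eq0 x x1) -(subr_eq0 y y1) -(subr_eq0 x' x1') -(subr_eq0 y' y1').
set dx := x - x1; set dy := y - y1; set dx' := x' - x1'; set dy' := y' - y1'.
move=> zw zw' /eqP e /eqP e1 /eqP e2 /eqP e3 /eqP e4.
have f1 : a * dx + b * dy = 0.
  transitivity (a * x + b * y - (a * x1 + b * y1)); first by rewrite /dx /dy; ring.
  by rewrite e1 e2 subrr.
have f2 : a' * dx' + b' * dy' = 0.
  transitivity (a' * x' + b' * y' - (a' * x1' + b' * y1')).
    by rewrite /dx' /dy'; ring.
  by rewrite e3 e4 subrr.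
have f : dx * dy' = dx' * dy.
  apply: subr0_eq; have [a0|a0] := eqVneq a 0.
    have b0 : b != 0 by move: ab; rewrite a0 xpair_eqE eqxx.
    have a'0 : a' = 0.
      by move/eqP: e; rewrite a0 mul0r eq_sym mulf_eq0 (negbTE b0) orbF => /eqP.
    have b'0 : b' != 0 by move: ab'; rewrite a'0 xpair_eqE eqxx.
    apply: (mulfI (mulf_neq0 b0 b'0)); rewrite mulr0.
    transitivity (dx * b * (a' * dx' + b' * dy') - dx' * b' * (a * dx + b * dy)).
      by rewrite a0 a'0; ring.
    by rewrite f1 f2 !mulr0 subrr.
  have a'0 : a' != 0.
    apply: contraNneq ab' => a'0; move/eqP: e.
    by rewrite a'0 mul0r mulf_eq0 (negbTE a0) /= => /eqP->; rewrite eqxx.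
  apply: (mulfI (mulf_neq0 a0 a'0)); rewrite mulr0.
  transitivity (a' * dy' * (a * dx + b * dy) - a * dy * (a' * dx' + b' * dy')
                + dy * dy' * (a * b' - a' * b)); first by ring.
  by rewrite f1 f2 e; ring.
have [l [ex ey]] : exists l, dx' = l * dx /\ dy' = l * dy.
  have [dx0|dx0] := eqVneq dx 0.
    have dy0 : dy != 0 by move: zw; rewrite dx0 eqxx.
    move/eqP: f; rewrite dx0 mul0r eq_sym mulf_eq0 (negbTE dy0) orbF => /eqP->.
    by exists (dy' / dy); rewrite mulr0; split; [|field].
  by exists (dx' / dx); split; [field | rewrite mulrAC -f; field].
exists l, (x' - l * x, y' - l * y); split.
- by apply: contraNneq zw' => l0; rewrite ex ey l0 !mul0r eqxx.
- by congr (_, _); rewrite /=; ring.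
- by congr (_, _) => /=; [have := ex | have := ey]; rewrite /dx /dx' /dy /dy';
    [move/(congr1 (fun u => x' - u)) | move/(congr1 (fun u => y' - u))]; 
    rewrite subKr => ->; ring.
Qed.

End AffinePlane.

(** * Cylindrifications as changes of coordinates *)

Section Cylindrifications.
Context {n : nat} {U : finType}.
Local Notation V := {ffun 'I_n.+3 -> U}.
Implicit Types (s : V) (a : U) (Z : {set V}).

Definition upd s i a : V := [ffun j => if j == i then a else s j].

(** A point with prescribed first two coordinates; the value of the others is
    immaterial for the sets closed under changes of coordinates from [i2] on. *)
Definition couple a b : V := [ffun i => if i == i0 then a else b].

Lemma couple0 a b : couple a b i0 = a. Proof. by rewrite ffunE. Qed.
Lemma couple1 a b : couple a b i1 = b. Proof. by rewrite ffunE. Qed.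

Lemma CsP i Z s :
  reflect (exists2 s', s' \in Z & forall j, j != i -> s j = s' j) (s \in Cs i Z).
Proof.
rewrite inE; apply: (iffP exists_inP) => -[s' s'Z h]; exists s' => //.
  by move=> j ji; apply/eqP; exact: (implyP (forallP h j)).
by apply/forallP => j; apply/implyP => ji; rewrite h.
Qed.

Lemma CsE i Z s : (s \in Cs i Z) = [exists a, upd s i a \in Z].
Proof.
apply/CsP/existsP => [[s' s'Z h]|[a aZ]]; last first.
  by exists (upd s i a) => // j ji; rewrite ffunE (negbTE ji).
exists (s' i); suff -> : upd s i (s' i) = s' by [].
by apply/ffunP => j; rewrite ffunE; case: eqP => [->|/eqP/h].
Qed.

Lemma sub_Cs i Z : Z \subset Cs i Z.
Proof. by apply/subsetP => s sZ; apply/CsP; exists s. Qed.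

Lemma CsSs i (t : 'S_n.+3) Z : Cs i (Ss t Z) = Ss t (Cs ((t^-1)%g i) Z).
Proof.
apply/setP => s; rewrite CsE [RHS]inE CsE; apply: eq_existsb => a.
rewrite inE; congr (_ \in Z); apply/ffunP => j; rewrite !ffunE.
by rewrite (canF_eq (permK t)).
Qed.

Lemma in_Ss t Z s : (s \in Ss t Z) = ([ffun i => s (t i)] \in Z).
Proof. by rewrite inE. Qed.

Lemma Ss1 Z : Ss 1%g Z = Z.
Proof.
apply/setP => s; rewrite inE; congr (_ \in Z).
by apply/ffunP => i; rewrite ffunE perm1.
Qed.

Lemma SsM t t' Z : Ss t (Ss t' Z) = Ss (t' * t)%g Z.
Proof.
apply/setP => s; rewrite !inE; congr (_ \in Z).
by apply/ffunP => i; rewrite !ffunE permM.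
Qed.

Lemma foldr_Cs_agree (l : seq 'I_n.+3) Z s s' :
  (forall j, j \notin l -> s j = s' j) ->
  s \in foldr Cs Z l -> s' \in foldr Cs Z l.
Proof.
elim: l s s' => [|i l IH] s s' ss' /=.
  by suff -> : s = s' by []; apply/ffunP => j; apply: ss'.
case/CsP => t tZ st; apply/CsP; exists (upd s' i (t i)); last first.
  by move=> j ji; rewrite ffunE (negbTE ji).
apply: IH tZ => j jl; rewrite ffunE; case: eqVneq => [->//|ji].
by rewrite -st // ss' // inE negb_or ji.
Qed.

Lemma sub_foldr_Cs (l : seq 'I_n.+3) Z : Z \subset foldr Cs Z l.
Proof. by elim: l => //= i l IH; apply: subset_trans IH (sub_Cs _ _). Qed.

End Cylindrifications.

(** * Symmetries of the construction and the sets of the algebra *)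

Section Symmetries.
Context {n p : nat} (d : construction n p).
Local Notation RT0 := (RT d ord0).
Local Notation ptd := (@pt n p d).
Implicit Types (g : {perm U d}) (s : points d) (Z : {set points d}).

Lemma Uk_uniq u k l : u \in Uk d k -> u \in Uk d l -> k = l.
Proof.
move=> uk ul; apply: contraTeq uk => /Uk_disjoint/pred0P/(_ u) /=.
by rewrite ul andbT => ->.
Qed.

Lemma Uk_exists u : exists k, u \in Uk d k.
Proof.
have : u \in \bigcup_k Uk d k by rewrite Uk_cover inE.
by case/bigcupP => k _; exists k.
Qed.

Lemma pt_Uk z : pt z \in Uk d ord0.
Proof. by rewrite -pt_im imset_f. Qed.

Lemma Uk0_pt u : u \in Uk d ord0 -> exists z, u = pt z.
Proof. by rewrite -pt_im => /imsetP[z _ ->]; exists z. Qed.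

Lemma Lam_class k : Lam d k \in parallel_classes (GF d).
Proof. by rewrite -Lam_im imset_f. Qed.

Lemma Rel_pt k z w : Rel ptd (Lam d k) (pt z : U d) (pt w) =
  (z != w) && collinear_in (Lam d k) z w.
Proof.
rewrite /Rel (inj_eq (@pt_inj n p d)); congr andb; apply: eq_existsb => L.
by rewrite !(mem_imset _ _ (@pt_inj n p d)).
Qed.

Lemma RelP k (u v : U d) : Rel ptd (Lam d k) u v -> exists z w, u = pt z /\ v = pt w.
Proof.
case/andP=> _ /exists_inP[L _ /andP[/imsetP[z _ ->] /imsetP[w _ ->]]].
by exists z, w.
Qed.

(** A symmetry acts on [U_0] as a homothety or translation, and permutes each
    other [U_k] arbitrarily. It preserves all the relations [R_i], but it may
    destroy the pieces [Q_k]. *)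
Definition symmetry g : bool :=
  [exists l, exists t, (l != 0%R) && [forall z, g (pt z) == pt (homothety l t z)]]
  && [forall k, forall u in Uk d k, g u \in Uk d k].

Lemma symmetryP g :
  reflect ((exists l t, l != 0%R /\ forall z, g (pt z) = pt (homothety l t z)) /\
           (forall k u, u \in Uk d k -> g u \in Uk d k)) (symmetry g).
Proof.
apply: (iffP andP) => -[h1 h2]; split.
- case/existsP: h1 => l /existsP[t /andP[l0 /forallP h]].
  by exists l, t; split=> // z; apply/eqP.
- by move=> k; apply/forall_inP/(forallP h2).
- case: h1 => l [t [l0 h]]; apply/existsP; exists l; apply/existsP; exists t.
  by rewrite l0; apply/forallP => z; rewrite h.
- by apply/forallP => k; apply/forall_inP => u; apply: h2.
Qed.

Lemma symmetryV g : symmetry g -> symmetry g^-1.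
Proof.
case/symmetryP=> -[l [t [l0 gpt]] gU]; apply/symmetryP; split.
  exists l^-1%R, (- l^-1 * t.1, - l^-1 * t.2)%R; split; first by rewrite invr_eq0.
  move=> z; apply: (canLR (permK g)); rewrite gpt; congr pt.
  by case: z => x y; congr (_, _); rewrite /=; field.
move=> k u uk; have [m um] := Uk_exists ((g^-1)%g u).
by have := gU _ _ um; rewrite permKV => /(Uk_uniq uk) ->.
Qed.

Definition block u : 'I_n.+2 := odflt ord0 [pick k | u \in Uk d k].

Lemma blockE u k : u \in Uk d k -> block u = k.
Proof.
rewrite /block => uk; case: pickP => [l ul|/(_ k)]; last by rewrite uk.
exact: Uk_uniq ul uk.
Qed.

Lemma mem_block u : u \in Uk d (block u).
Proof. by have [k uk] := Uk_exists u; rewrite (blockE uk). Qed.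

Lemma symmetry_exists l t (f : 'I_n.+2 -> {perm U d}) :
  l != 0%R -> (forall k u, k != ord0 -> u \in Uk d k -> f k u \in Uk d k) ->
  exists g, [/\ symmetry g, forall z, g (pt z) = pt (homothety l t z) &
                forall k u, k != ord0 -> u \in Uk d k -> g u = f k u].
Proof.
move=> l0 fU.
pose z_of u := odflt (0, 0)%R [pick z | pt z == u :> U d].
have z_ofK z : z_of (pt z) = z.
  by rewrite /z_of; case: pickP => [w /eqP/pt_inj//|/(_ z)]; rewrite eqxx.
pose h u := if block u == ord0 then pt (homothety l t (z_of u)) else f (block u) u.
have hpt z : h (pt z) = pt (homothety l t z).
  by rewrite /h (blockE (pt_Uk z)) eqxx z_ofK.
have hU k u : k != ord0 -> u \in Uk d k -> h u = f k u.
  by move=> k0 uk; rewrite /h (blockE uk) (negbTE k0).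
have h_stab k u : u \in Uk d k -> h u \in Uk d k.
  have [->/Uk0_pt[z ->]|k0 uk] := eqVneq k ord0; first by rewrite hpt pt_Uk.
  by rewrite (hU k) // fU.
have h_inj : injective h.
  move=> u v huv; have uv : block u = block v.
    by rewrite -(blockE (h_stab _ _ (mem_block u))) huv (blockE (h_stab _ _ (mem_block v))).
  have := mem_block v; have := mem_block u; move: uv huv => ->.
  have [->|k0] := eqVneq (block v) ord0.
    move=> huv /Uk0_pt[z uz] /Uk0_pt[w vw]; move: huv; rewrite uz vw !hpt.
    by move/pt_inj/(homothety_inj l0) ->.
  by move=> huv uk vk; move: huv; rewrite !(hU (block v)) // => /perm_inj.
exists (perm h_inj); split=> [|z|k u k0 uk]; rewrite ?permE ?hpt ?(hU k) //.
apply/symmetryP; split; last by move=> k u uk; rewrite permE h_stab.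
by exists l, t; split=> // z; rewrite permE hpt.
Qed.

Definition act g s : points d := [ffun i => g (s i)].

Lemma actK g s : act g^-1 (act g s) = s.
Proof. by apply/ffunP => i; rewrite !ffunE permK. Qed.

Lemma act_Ss g t Z s : (act g s \in Ss t Z) = (act g [ffun i => s (t i)] \in Z).
Proof. by rewrite inE; congr (_ \in Z); apply/ffunP => i; rewrite !ffunE. Qed.

Definition invariant Z : Prop := forall g s, symmetry g -> s \in Z -> act g s \in Z.

Lemma invariant_RT k : invariant (RT d k).
Proof.
move=> g s /symmetryP[[l [t [l0 gpt]]] gU]; rewrite !inE !ffunE => /andP[hR /forallP hT].
have [z [w [ez ew]]] := RelP hR; rewrite ez ew Rel_pt in hR *; rewrite !gpt Rel_pt.
rewrite (inj_eq (homothety_inj l0)); case/andP: hR => -> /=.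
move/(homothety_collinear t (Lam_class k) l0) => -> /=.
by apply/forallP => m; rewrite ffunE; apply/implyP => m0; apply/gU/(implyP (hT m)).
Qed.

Lemma RT_coord k s (m : 'I_n.+2) : s \in RT d k -> m != ord0 -> s (lift ord0 m) \in Uk d m.
Proof. by rewrite inE => /andP[_ /forallP/(_ m)/implyP]. Qed.

(** The first two coordinates are matched by a homothety, and each coordinate
    in [U_k], [k >= 1], by a transposition of [U_k]. *)
Lemma RT_transitive k s s' : s \in RT d k -> s' \in RT d k ->
  exists2 g, symmetry g & act g s = s'.
Proof.
move=> sR sR'; have := sR; have := sR'; rewrite !inE => /andP[hR' _] /andP[hR _].
have [z [w [ez ew]]] := RelP hR; have [z' [w' [ez' ew']]] := RelP hR'.
move: hR hR'; rewrite ez ew ez' ew' !Rel_pt => /andP[zw c] /andP[zw' c'].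
have [l [t [l0 hz hw]]] := homothety_transitive (Lam_class k) zw zw' c c'.
have [|g [gS gpt gU]] := @symmetry_exists l t
  (fun m => tperm (s (lift ord0 m)) (s' (lift ord0 m))) l0.
  by move=> m u m0 um /=; case: tpermP => // _; apply: (RT_coord _ m0); eassumption.
exists g => //; apply/ffunP => i; rewrite ffunE.
case: (unliftP ord0 i) => [m ->|->]; last by rewrite -/i0 ez gpt hz.
have [->|m0] := eqVneq m ord0; last by rewrite (gU m) ?tpermL // (RT_coord sR).
have -> : lift ord0 (ord0 : 'I_n.+2) = i1 by apply: val_inj.
by rewrite ew gpt hw.
Qed.

(** The region of the space that the pieces [Q_k] and their images [S_t Q_k]
    split below the orbits of the symmetries. *)
Definition splintered : {set points d} := \bigcup_t Ss t RT0.

(** Outside the splintered region a tame set is a union of orbits of the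
    symmetries; inside, it is a union of sets [S_t Q_k]. *)
Definition tame Z : bool :=
  [forall g, forall s in Z, symmetry g ==> (s \notin splintered) ==> (act g s \in Z)]
  && [forall t, forall k, (Ss t (Q d k) \subset Z) || [disjoint Ss t (Q d k) & Z]].

Lemma tameP Z :
  reflect ((forall g s, symmetry g -> s \in Z -> s \notin splintered -> act g s \in Z) /\
    (forall t k s s', s \in Ss t (Q d k) -> s' \in Ss t (Q d k) -> s \in Z -> s' \in Z))
  (tame Z).
Proof.
apply: (iffP andP) => -[h1 h2]; split.
- move=> g s gS sZ sN; have /forall_inP/(_ _ sZ)/implyP/(_ gS) := forallP h1 g.
  by move/implyP; apply.
- move=> t k s s' sQ s'Q sZ; have := forallP (forallP h2 t) k.
  case/orP => [/subsetP h|]; first exact: h.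
  by move=> /pred0P/(_ s) /=; rewrite sQ sZ.
- apply/forallP => g; apply/forall_inP => s sZ; apply/implyP => gS.
  by apply/implyP; apply: h1.
- apply/forallP => t; apply/forallP => k; rewrite orbC -implyNb.
  apply/implyP => /pred0Pn[s /andP[sQ sZ]]; apply/subsetP => s' s'Q; exact: (h2 t k s).
Qed.

Lemma invariant_splintered : invariant splintered.
Proof.
move=> g s gS /bigcupP[t _ st]; apply/bigcupP; exists t => //.
by rewrite act_Ss; apply: invariant_RT gS _; rewrite inE in st.
Qed.

Lemma Q_sub_RT k : Q d k \subset RT0.
Proof. by rewrite /RT -Q_cover; apply: bigcup_sup. Qed.

(** The symmetries act transitively on [R_0 x T], so that an invariant set
    containing a point of [S_t Q_k] contains all of [S_t (R_0 x T)]. *)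
Lemma invariant_tame Z : invariant Z -> tame Z.
Proof.
move=> iZ; apply/tameP; split=> [g s gS sZ _|t k s s']; first exact: iZ.
rewrite !inE => /(subsetP (Q_sub_RT k)) sR /(subsetP (Q_sub_RT k)) sR' sZ.
have [g gS e] := RT_transitive sR sR'.
suff -> : s' = act g s by apply: iZ.
apply/ffunP => i; rewrite -(permKV t i); have /ffunP/(_ ((t^-1)%g i)) := e.
by rewrite !ffunE permKV => ->.
Qed.

(** Cylindrification hides the pieces, since [Q_k] and
    [R_0 x T] have the same cylindrifications. *)
Lemma tame_Cs_invariant i Z : tame Z -> invariant (Cs i Z).
Proof.
move=> /tameP[hg hQ] g s gS /CsP[s1 s1Z ss1].
have agree j : j != i -> act g s j = act g s1 j by move=> ji; rewrite !ffunE ss1.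
have [/bigcupP[t _ s1t]|s1N] := boolP (s1 \in splintered); last first.
  by apply/CsP; exists (act g s1) => //; apply: hg.
have [k s1k] : exists k, s1 \in Ss t (Q d k).
  rewrite inE /RT -Q_cover in s1t; case/bigcupP: s1t => k _ h.
  by exists k; rewrite inE.
(* act g s1 may lie in another piece of Ss t RT0 than s1; Q_cyl replaces it by
   a point s2 of the same piece as s1. *)
have : act g s \in Cs i (Ss t RT0).
  apply/CsP; exists (act g s1) => //; rewrite act_Ss; apply: invariant_RT => //.
  by rewrite inE in s1t.
rewrite CsSs /RT -(Q_cyl d k) -CsSs => /CsP[s2 s2k ss2].
by apply/CsP; exists s2 => //; apply: (hQ t k s1).
Qed.

Lemma RT_block k s i : s \in RT d k -> s i \in Uk d (inord i.-1).
Proof.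
move=> sR; case: (unliftP ord0 i) => [m ->|->].
  have [->|m0] := eqVneq m ord0.
    move: sR; rewrite inE => /andP[/RelP[z [w [_ ew]]] _].
    have -> : lift ord0 (ord0 : 'I_n.+2) = i1 by apply: val_inj.
    by rewrite ew (_ : inord _ = ord0) ?pt_Uk //; apply: val_inj; rewrite /= inordK.
  have -> : inord (lift ord0 m).-1 = m by rewrite -[RHS]inord_val.
  exact: RT_coord sR m0.
move: sR; rewrite inE => /andP[/RelP[z [w [ez _]]] _]; rewrite -/i0 ez.
by rewrite (_ : inord _ = ord0) ?pt_Uk //; apply: val_inj; rewrite /= inordK.
Qed.

(** A permutation of the coordinates that maps a point of [R x T] to one of
    [R' x T] preserves the block of each coordinate; the first two coordinates
    are the only ones to share a block. *)
Lemma RT_reindex k l s (t : 'S_n.+3) :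
  s \in RT d k -> [ffun i => s (t i)] \in RT d l -> t = 1%g \/ t = tperm i0 i1.
Proof.
move=> sR stR.
have tE i : (t i).-1 = i.-1.
  have := RT_block i stR; rewrite ffunE => /(Uk_uniq (RT_block (t i) sR)).
  move/(congr1 val); rewrite /= !inordK //.
    by case: i => -[|j] //= /ltnW.
  by case: (t i) => -[|j] //= /ltnW.
have t01 (i : 'I_n.+3) : i.-1 = 0 -> t i = i0 \/ t i = i1.
  move=> i01; have := tE i; rewrite i01.
  by case: (t i) => -[|[|j]] //= lt _; [left|right]; apply: val_inj.
have t_ge2 (i : 'I_n.+3) : 1 < i -> t i = i.
  move=> i_gt1; apply: val_inj => /=; have := tE i.
  by case: (nat_of_ord i) i_gt1 => [|[|j]] //= _; case: (nat_of_ord (t i)) => //= x ->.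
have ord01 (i : 'I_n.+3) : [\/ i = i0, i = i1 | 1 < i].
  by case: i => -[|[|j]] lt; [apply: Or31|apply: Or32|apply: Or33] => //; apply: val_inj.
have t_inj := @perm_inj _ t.
have [e0|e0] := t01 i0 erefl; have [e1|e1] := t01 i1 erefl.
- by have := t_inj _ _ (etrans e0 (esym e1)).
- left; apply/permP => i; rewrite perm1.
  by case: (ord01 i) => [->|->|/t_ge2].
- right; apply/permP => i; case: (ord01 i) => [->|->|i_gt1].
  + by rewrite tpermL.
  + by rewrite tpermR.
  + by rewrite t_ge2 // tpermD //; apply: contraTneq i_gt1 => <-.
- by have := t_inj _ _ (etrans e0 (esym e1)).
Qed.

(** The only image of [Q_m] by a permutation of coordinates, other than [Q_m],
    that meets [R_0 x T] is [P_01 Q_m], which is again one of the pieces. *)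
Lemma tame_Q k : tame (Q d k).
Proof.
apply/tameP; split=> [g s _ sQ /negP[]|t m s s' sm s'm sk].
  apply/bigcupP; exists 1%g; rewrite // Ss1.
  exact: (subsetP (Q_sub_RT k)).
suff [k' e] : exists k', Ss t (Q d m) = Q d k'.
  move: sm s'm; rewrite e => sk' s'k'; suff -> : k = k' by [].
  apply: contraTeq sk => /Q_disjoint/pred0P/(_ s) /=; rewrite sk' andbT => ->.
  by [].
have stR : [ffun i => s (t i)] \in RT0 by apply: (subsetP (Q_sub_RT m)); rewrite inE in sm.
have [t1|tx] := RT_reindex (subsetP (Q_sub_RT k) _ sk) stR.
  by exists m; rewrite t1 Ss1.
by exists (rev_ord m); rewrite tx -Q_swap.
Qed.

Lemma tame_setU Z Z' : tame Z -> tame Z' -> tame (Z :|: Z').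
Proof.
move=> /tameP[h1 h2] /tameP[h1' h2']; apply/tameP; split=> [g s gS|t k s s' sQ s'Q].
  by rewrite !inE => /orP[sZ|sZ] sN; apply/orP; [left; apply: h1 | right; apply: h1'].
rewrite !inE => /orP[sZ|sZ]; first by rewrite (h2 _ _ _ _ sQ s'Q).
by rewrite (h2' _ _ _ _ sQ s'Q) ?orbT.
Qed.

Lemma tame_setC Z : tame Z -> tame (~: Z).
Proof.
move=> /tameP[h1 h2]; apply/tameP; split=> [g s gS|t k s s' sQ s'Q]; last first.
  by rewrite !inE; apply: contra; apply: (h2 t k).
rewrite !inE => sZ sN; apply: contra sZ => sZ.
rewrite -(actK g s); apply: h1 => //; first exact: symmetryV.
by apply: contra sN => /(invariant_splintered (symmetryV gS)); rewrite actK.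
Qed.

Lemma tame_Ss t Z : tame Z -> tame (Ss t Z).
Proof.
move=> /tameP[h1 h2]; apply/tameP; split=> [g s gS|t' k s s' sQ s'Q].
  rewrite act_Ss inE => sZ sN; apply: h1 => //; apply: contra sN.
  case/bigcupP=> t' _ st'; apply/bigcupP; exists (t' * t)%g => //.
  by rewrite -SsM inE.
rewrite -[t'](mulgKV t) -SsM in_Ss in sQ; rewrite -[t'](mulgKV t) -SsM in_Ss in s'Q.
by rewrite !in_Ss; apply: h2 sQ s'Q.
Qed.

(** The tame sets have the closure properties that define the algebra: a
    cylindrification is invariant, hence tame, and the Boolean operations and
    the permutations of coordinates preserve both the orbits of the symmetries
    and the family of the sets [S_t Q_k]. *)
Lemma A_tame Z : Z \in A d -> tame Z.
Proof.
have /subsetP sub : A d \subset [set Z | tame Z].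
  apply: A_min.
    apply/subsetP => Z0; rewrite inE => /orP[/setUP[]|].
    - by case/imsetP=> k _ ->; rewrite inE tame_Q.
    - case/imsetP=> k _ ->; rewrite inE; exact/invariant_tame/invariant_RT.
    - case/imset2P=> i j _ _ ->; rewrite inE; apply: invariant_tame => g s _.
      by rewrite !inE !ffunE => /eqP->.
  apply/and4P; split.
  - apply/forall_inP => Z1; rewrite inE => h1; apply/forall_inP => Z2.
    by rewrite !inE; apply: tame_setU.
  - by apply/forall_inP => Z1; rewrite !inE; apply: tame_setC.
  - apply/forallP => i; apply/forall_inP => Z1; rewrite !inE => h.
    exact/invariant_tame/tame_Cs_invariant.
  - apply/forallP => i; apply/forallP => j; apply/forall_inP => Z1; rewrite !inE.
    exact: tame_Ss.
by move/sub; rewrite inE.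
Qed.

End Symmetries.

(** * Affine planes invariant under the symmetries *)

(** The point set [X] is [U_0], so that [q ^ 2 = p ^ 2]. First, [X] avoids
    [U_k] for [k >= 1]: if [w] is in [X] and [U_k] and [w'] is another point of
    [U_k], then [w'] is in [X] as the transposition of [w] and [w'] is a
    symmetry. Let the line of [w] and [w'] be of class [i]; a class [j != i]
    has a line joining [w] to some [z]. The transposition fixes [z], so [z] is
    joined to [w'] in class [j] as well, and then so is [w], a contradiction.
    Secondly, [X] is invariant under the translations of [U_0]. *)
Lemma symmetric_plane_order n p (d : construction n p) q (X : {set U d})
    (r : 'I_q.+1 -> rel (U d)) u :
  2 < p -> 1 < q -> plane_relations X r ->
  (forall g k a b, symmetry g -> r k a b -> r k (g a) (g b)) ->
  u \in X -> q = p.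
Proof.
move=> p_gt2 q_gt1 HX r_inv uX.
have [r_in r_sym r_tr r_ser [r_cov r_dis _]] := HX.
have X_inv g a : symmetry g -> a \in X -> g a \in X.
  by move=> gS /(r_ser ord0)[b /(r_inv _ _ _ _ gS)/r_in[]].
have X_plane w : w \in X -> w \in Uk d ord0.
  move=> wX; have [k wk] := Uk_exists w.
  have [<-//|k0] := eqVneq k ord0.
  have [w' w'k ww'] : exists2 w', w' \in Uk d k & w' != w.
    have : 1 < #|Uk d k| by rewrite card_Uk // ltn_predRL.
    rewrite (cardsD1 w) wk ltnS.
    by case/card_gt0P => w'; rewrite !inE => /andP[]; exists w'.
  have gS : symmetry (tperm w w').
    apply/symmetryP; split.
      exists 1%R, (0, 0)%R; split; first exact: oner_neq0.
      move=> z; have z0 := pt_Uk z; rewrite tpermD.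
      - by congr pt; case: z {z0} => x y; rewrite /homothety /= !mul1r !addr0.
      - by apply: contraNneq k0 => wz; rewrite -wz in z0; rewrite (Uk_uniq wk z0).
      - by apply: contraNneq k0 => wz; rewrite -wz in z0; rewrite (Uk_uniq w'k z0).
    move=> m v vm; case: tpermP => [e|e|] //; rewrite e in vm.
      by rewrite (Uk_uniq vm wk).
    by rewrite (Uk_uniq vm w'k).
  have w'X : w' \in X by rewrite -(tpermL w w') X_inv.
  have [|i rww'] := r_cov w w' wX w'X; first by rewrite eq_sym.
  have [j jNi] := exists_neq_ord i (ltnW q_gt1).
  have [z rwz] := r_ser j w wX; have [_ _ wz] := r_in _ _ _ rwz.
  have w'z : w' != z.
    by apply: contraNneq jNi => e; rewrite -e in rwz; rewrite (r_dis _ _ _ _ rwz rww').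
  have := r_inv _ _ _ _ gS rwz; rewrite tpermL tpermD // => /r_sym rzw'.
  have [e|rj] := r_tr _ _ _ _ rwz rzw'; first by rewrite e eqxx in ww'.
  by rewrite (r_dis _ _ _ _ rj rww') eqxx in jNi.
have XE : X = Uk d ord0.
  apply/eqP; rewrite eqEsubset; apply/andP; split; apply/subsetP => // v.
  case/Uk0_pt => z ->; have [z0 uE] := Uk0_pt (X_plane u uX).
  pose t := (z.1 - z0.1, z.2 - z0.2)%R.
  have [|//|g [gS gpt _]] := @symmetry_exists n p d 1%R t (fun=> 1%g).
  - exact: oner_neq0.
  - by move=> k w _; rewrite perm1.
  suff -> : pt z = g u by apply: X_inv.
  rewrite uE gpt; congr pt; case: z z0 @t {uE gpt} => x y [x0 y0].
  by rewrite /homothety /= !mul1r ![(_ + (_ - _))%R]addrC !subrK.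
have := plane_card q_gt1 HX uX; rewrite XE -pt_im card_imset; last exact: pt_inj.
by rewrite cardsT card_prod card_GF mulnn => /eqP; rewrite eqn_exp2r // => /eqP ->.
Qed.

(** * The equations, read in the algebra *)

Lemma all_flatten_map (S : eqType) T (f : S -> seq T) (l : seq S) (P : pred T) :
  all P (flatten [seq f x | x <- l]) -> {in l, forall x, all P (f x)}.
Proof.
elim: l => //= y l IH; rewrite all_cat => /andP[Py Pl] x.
by rewrite inE => /predU1P[->//|]; apply: IH.
Qed.

Lemma all_catP T (P : pred T) (s1 s2 : seq T) :
  reflect (all P s1 /\ all P s2) (all P (s1 ++ s2)).
Proof. by rewrite all_cat; apply: andP. Qed.

Section Terms.
Context {n p : nat} (d : construction n p) (v : var -> Astar d).
Implicit Types (t : term n) (s : points d).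

Definition sem t : {set points d} := sval (eval v t).

Lemma sem_A t : sem t \in A d.
Proof. exact: valP (eval v t). Qed.

Lemma sem_add t t' : sem (TAdd t t') = sem t :|: sem t'. Proof. by []. Qed.
Lemma sem_diag i j : sem (TDiag i j) = Ds i j. Proof. by []. Qed.
Lemma sem_compl t : sem (TCompl t) = ~: sem t. Proof. by []. Qed.
Lemma sem_cyl i t : sem (TCyl i t) = Cs i (sem t). Proof. by []. Qed.

Lemma sem_mul t t' : sem (tmul t t') = sem t :&: sem t'.
Proof. by rewrite !(sem_compl, sem_add) setCU !setCK. Qed.

Lemma sem_one : sem tone = setT.
Proof. exact: setUCr. Qed.

Lemma sem_zero : sem tzero = set0.
Proof. by rewrite sem_compl sem_one setCT. Qed.

Lemma sem_sum ts s : (s \in sem (tsum ts)) = has (fun t => s \in sem t) ts.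
Proof.
elim: ts => [|t ts IH]; first by rewrite sem_zero inE.
by rewrite sem_add inE IH.
Qed.

Lemma sem_prod ts s : (s \in sem (tprod ts)) = all (fun t => s \in sem t) ts.
Proof.
elim: ts => [|t ts IH]; first by rewrite sem_one inE.
by rewrite sem_mul inE IH.
Qed.

Lemma sem_cyls m t :
  sem (tcyls m t) = foldr Cs (sem t) [seq i : 'I_n.+3 <- enum 'I_n.+3 | m <= i].
Proof. by rewrite /tcyls; elim: (filter _ _) => //= i l <-. Qed.

Lemma sem_subst i j t s :
  i != j -> (s \in sem (tsubst i j t)) = (upd s i (s j) \in sem t).
Proof.
rewrite eq_sym => ji; rewrite sem_cyl CsE sem_mul sem_diag.
apply/existsP/idP => [[a]|h].
  by rewrite !inE !ffunE eqxx (negbTE ji) => /andP[/eqP->].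
by exists (s j); rewrite !inE h !ffunE eqxx (negbTE ji) eqxx.
Qed.

Definition satisfied (e : equation n) : bool := sem e.1 == sem e.2.

(** In a full space [c_0 c_1 ... c_(alpha-1)] maps every nonempty set to the
    whole space, so the product vanishes as soon as one equation fails. The
    premise quantifies over a point because over an empty space every equation
    is true. *)
Lemma eqn_e_holds q : (forall s, ~~ all satisfied (eqns_E n q)) ->
  eval v (eqn_e n q).1 = eval v (eqn_e n q).2.
Proof.
move=> h; apply: val_inj; rewrite -[LHS]/(sem _) -[RHS]/(sem _) sem_zero.
apply/setP => s; rewrite [RHS]inE sem_prod; apply: contraNF (h s).
rewrite all_map; apply: sub_all => e /=; rewrite sem_compl inE sem_cyls => sN.
have e0 : sem (tsymd e.1 e.2) = set0.
  apply/setP => s'; rewrite [RHS]inE; apply: contraNF sN => s'Z.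
  apply: foldr_Cs_agree (subsetP (sub_foldr_Cs _ _) _ s'Z) => j.
  by rewrite mem_filter mem_enum.
apply/eqP/setP => s'; move/setP/(_ s'): e0.
by rewrite sem_add !sem_mul !sem_compl !inE; do 2![case: (_ \in _)].
Qed.

Lemma mem_neq_pairs m i j :
  i < m -> j < m -> i != j -> (i, j) \in neq_pairs m.
Proof.
move=> im jm ij; rewrite mem_filter ij; apply/allpairsP; exists (i, j).
by rewrite !mem_iota !add0n.
Qed.

(** The binary relation behind [x_k], which depends on the first two
    coordinates only when the equations hold. *)
Definition xrel q (k : 'I_q.+1) (a b : U d) : bool :=
  couple a b \in sem (TVar (X k)).

Definition xdom : {set U d} := [set a | [exists b, @xrel 0 ord0 a b]].

Context {q : nat} (sat : all satisfied (eqns_E n q)).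
Local Notation x k := (sem (TVar (X k))).

Lemma sat_x1 (i : 'I_q.+1) : all satisfied (E_x1 n q i).
Proof.
have /all_catP[_ /all_catP[/all_flatten_map h _]] := sat.
by apply: h; rewrite mem_iota add0n ltn_ord.
Qed.

Lemma sat_x2 (i j : 'I_q.+1) : i != j -> all satisfied (E_x2 n q i j).
Proof.
move=> ij; have /all_catP[_ /all_catP[_ /all_catP[/all_flatten_map h _]]] := sat.
exact: (h (val i, val j) (mem_neq_pairs (ltn_ord i) (ltn_ord j) ij)).
Qed.

Lemma x_closed (k : 'I_q.+1) :
  x k = foldr Cs (x k) [seq i : 'I_n.+3 <- enum 'I_n.+3 | 2 <= i].
Proof. by have /and5P[/eqP {1}-> _ _ _ _] := sat_x1 k; rewrite sem_cyls. Qed.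

Lemma x_xrel (k : 'I_q.+1) s : (s \in x k) = xrel k (s i0) (s i1).
Proof.
have agree s1 s2 : s1 i0 = s2 i0 -> s1 i1 = s2 i1 -> s1 \in x k -> s2 \in x k.
  rewrite x_closed => e0 e1; apply: foldr_Cs_agree => j.
  rewrite mem_filter mem_enum andbT -ltnNge; case: j => -[|[|//]] lt _.
    by rewrite (_ : Ordinal lt = i0) //; apply: val_inj.
  by rewrite (_ : Ordinal lt = i1) //; apply: val_inj.
by apply/idP/idP; apply: agree; rewrite !ffunE.
Qed.

(** [x_k] is a cylindrification of a member of the algebra, namely in the
    direction [i2]. *)
Lemma x_invariant (k : 'I_q.+1) : invariant (x k).
Proof.
rewrite x_closed; have : i2 \in [seq i : 'I_n.+3 <- enum 'I_n.+3 | 2 <= i].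
  by rewrite mem_filter mem_enum.
case: (filter _ _) => // i l _; apply/tame_Cs_invariant/A_tame.
by elim: l => [|j l IH]; [apply: sem_A | apply: A_Cs].
Qed.

Lemma xrel_sym (k : 'I_q.+1) a b : xrel k a b -> xrel k b a.
Proof.
have /and5P[_ /eqP e _ _ _] := sat_x1 k; rewrite {1}/xrel e.
by rewrite !sem_subst // x_xrel !ffunE.
Qed.

Lemma in_comp (i j : 'I_q.+1) s :
  (s \in sem (tcomp (TVar (X i)) (TVar (X j)))) =
  [exists c, xrel i (s i0) c && xrel j c (s i1)].
Proof.
rewrite sem_cyl CsE; apply: eq_existsb => c.
by rewrite sem_mul inE !sem_subst // !x_xrel !ffunE.
Qed.

Lemma xrel_trans (k : 'I_q.+1) a b c : xrel k a b -> xrel k b c -> a = c \/ xrel k a c.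
Proof.
move=> ab bc; have /and5P[_ _ /eqP/setP e _ _] := sat_x1 k.
have := e (couple a c).
rewrite !sem_add sem_diag !in_setU in_comp x_xrel !inE !ffunE /=.
have -> : [exists c', xrel k a c' && xrel k c' c] by apply/existsP; exists b; rewrite ab.
by move=> /esym/orP[|/eqP]; [right|left].
Qed.

Lemma mem_xdom (k : 'I_q.+1) a : (a \in xdom) = [exists b, xrel k a b].
Proof.
have dom (m : 'I_q.+1) :
    ([ffun => a] \in Cs i1 (x m)) = [exists b, xrel m a b].
  by rewrite CsE; apply: eq_existsb => b; rewrite x_xrel !ffunE.
have /and5P[_ _ _ /eqP e _] := sat_x1 k.
rewrite /= !sem_cyl in e; by rewrite inE -(dom k) e (dom ord0).
Qed.

(** The range of [xrel ord0] is also [xdom], by symmetry. *)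
Lemma has_xrel a b :
  [exists k : 'I_q.+1, xrel k a b] = [&& a \in xdom, b \in xdom & a != b].
Proof.
have /andP[/eqP/setP e _] := sat.
have := e (couple a b); rewrite sem_sum has_map.
rewrite !sem_mul sem_compl sem_diag !sem_cyl !in_setI in_setC !CsE.
rewrite inE couple0 couple1 => h.
apply/idP/idP => [/existsP[k hk]|/and3P[aX bX ab]].
  move: h; rewrite (_ : has _ _ = true); last first.
    by apply/hasP; exists (val k) => //; rewrite mem_iota add0n ltn_ord.
  move=> /esym/andP[/andP[/existsP[c1 h1] /existsP[c2 h2]] ->].
  rewrite !(@x_xrel ord0) !ffunE /= in h1 h2.
  rewrite !(@mem_xdom ord0) andbT; apply/andP; split; apply/existsP.
    by exists c1.
  by exists c2; apply: xrel_sym.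
move: h; rewrite ab andbT (_ : _ && _ = true).
  case/hasP => k; rewrite mem_iota add0n => /andP[_ kq] hk.
  by apply/existsP; exists (Ordinal kq).
apply/andP; split; apply/existsP.
  move: aX; rewrite (@mem_xdom ord0) => /existsP[c hc]; exists c.
  by rewrite (@x_xrel ord0) !ffunE.
move: bX; rewrite (@mem_xdom ord0) => /existsP[c hc]; exists c.
by rewrite (@x_xrel ord0) !ffunE; apply: xrel_sym.
Qed.

Lemma xrel_plane : plane_relations xdom (@xrel q).
Proof.
split; [|exact: xrel_sym|exact: xrel_trans| |split].
- move=> i u w h; apply/and3P; rewrite -has_xrel; apply/existsP; by exists i.
- by move=> i u; rewrite (mem_xdom i) => /existsP.
- by move=> u w uX wX uw; apply/existsP; rewrite has_xrel uX wX uw.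
- move=> i j u w hi hj; apply/eqP; apply: contraTT hi => ij.
  have /and3P[/eqP/setP e _ _] := sat_x2 ij.
  move: (e (couple u w)); rewrite sem_mul sem_zero !inE => /negbT.
  by rewrite negb_and [X in _ || ~~ X]hj orbF.
- move=> i j k u w ij ki kj hk.
  have /and3P[_ /eqP/setP/(_ (couple u w)) e _] := sat_x2 ij.
  move: e; rewrite in_comp sem_sum couple0 couple1 has_map (_ : has _ _ = true).
    by case/existsP => c /andP[]; exists c.
  apply/hasP; exists (val k) => //.
  by rewrite mem_filter mem_iota /= add0n ltn_ord !andbT; apply/andP.
Qed.

Lemma xdom_nonempty s : exists a, a \in xdom.
Proof.
have /and5P[_ _ _ _ /andP[/eqP/setP/(_ s) e _]] := sat_x1 ord0.
move: e; rewrite sem_one !sem_cyl [RHS]inE => /CsP[s1 /CsP[s2]].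
rewrite (@x_xrel ord0) => h _ _; exists (s2 i0).
by rewrite (@mem_xdom ord0); apply/existsP; exists (s2 i1).
Qed.

End Terms.

Lemma odd_prime_power_gt2 p : odd_prime_power p -> 2 < p.
Proof.
case=> p_odd [r [k [r_pr k_gt0 pE]]].
have : 1 < p by rewrite pE -(exp1n k) ltn_exp2r // prime_gt1.
by case: p p_odd {pE} => [|[|[|]]].
Qed.

Theorem lemma11 (n p : nat) (hp : odd_prime_power p) (d : construction n p)
  (q : nat) (hq : odd_prime_power q) (hqp : q <> p) :
  models (Astar d) (eqn_e n q).
Proof.
move=> v; apply: eqn_e_holds => s; apply/negP => sat.
have [u uX] := xdom_nonempty sat s.
apply: hqp; apply: (symmetric_plane_order _ _ (xrel_plane sat) _ uX).
- exact: odd_prime_power_gt2.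
- exact/ltnW/odd_prime_power_gt2.
move=> g k a b gS /(x_invariant sat gS); rewrite x_xrel //.
by rewrite !ffunE.
Qed.
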